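(* For an arbitrary connected graph $G=(V,E)$ with $m$ edges, $edim(G)$ can be approximated within a factor of $O(\log m)$ in polynomial time. That is, there exist a function $\alpha$ with $\alpha(m)=O(\log m)$ and a polynomial-time algorithm which, given any connected graph $G$ with $m$ edges, outputs a number $k$ with $edim(G)\le k\le \alpha(m)\cdot edim(G)$.
   Context: All graphs are finite and simple. For a connected graph $G=(V,E)$, $d_G(x,y)$ is the length of a shortest path between vertices $x,y$. The distance between a vertex $v$ and an edge $e=uw$ is $d_G(e,v)=\min\{d_G(u,v),d_G(w,v)\}$. A vertex $w$ distinguishes two edges $e_1,e_2$ if $d_G(w,e_1)\ne d_G(w,e_2)$. A set $S\subseteq V$ is an edge metric generator for $G$ if every two distinct edges of $G$ are distinguished by some vertex of $S$; the edge metric dimension $edim(G)$ is the smallest cardinality of an edge metric generator for $G$. *)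

(* Defs.v *)
From mathcomp Require Import all_boot.

Set Implicit Arguments.
Unset Strict Implicit.
Unset Printing Implicit Defensive.

Record sgraph := SGraph {
  svertex :> finType;
  sedge : rel svertex;
  sedge_sym : symmetric sedge;
  sedge_irrefl : irreflexive sedge
}.

Section EdgeMetricDimension.
Variable G : sgraph.

(* The graph without vertices does not count as connected. *)
Definition connected_graph : Prop :=
  0 < #|G| /\ forall x y : G, connect (@sedge G) x y.

Definition edges : {set {set G}} :=
  [set [set x; y] | x in G, y in G & sedge x y].

(* A path has fewer than #|G| edges, so only those lengths are searched;
   the value is #|G| when no path joins x and y. *)
Definition dist (x y : G) : nat :=
  find (fun k => [exists p : k.-tuple G,
          [&& path (@sedge G) x p, last x p == y & uniq (x :: p)]])
       (iota 0 #|G|).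

(* #|G| is neutral here, since dist u v <= #|G|. *)
Definition edge_dist (E : {set G}) (v : G) : nat :=
  \big[minn/#|G|]_(u in E) dist u v.

Definition distinguishes (w : G) (E1 E2 : {set G}) : bool :=
  edge_dist E1 w != edge_dist E2 w.

Definition edge_metric_generator (S : {set G}) : bool :=
  [forall E1 in edges, forall E2 in edges,
     (E1 != E2) ==> [exists w in S, distinguishes w E1 E2]].

Lemma dist_eq0 (x y : G) : (dist x y == 0) = (x == y).
Proof.
rewrite /dist; have G_gt0 : 0 < #|G| by apply/card_gt0P; exists x.
case: #|G| G_gt0 => //= n _; case: existsP => [[p]|nop].
  by rewrite tuple0 /= => /andP[-> _]; rewrite eqxx.
symmetry; apply/negP => xy; case: nop; exists [tuple]; rewrite /= xy.
by [].
Qed.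

Lemma edge_dist_eq0 (E : {set G}) (v : G) : (edge_dist E v == 0) = (v \in E).
Proof.
have G_gt0 : 0 < #|G| by apply/card_gt0P; exists v.
apply/idP/idP => [|vE]; last first.
  rewrite -leqn0 /edge_dist.
  elim: (index_enum G) (mem_index_enum v) => // u s IHs.
  rewrite inE big_cons; case/predU1P => [<-|/IHs le0].
    by rewrite vE geq_min leqn0 dist_eq0 eqxx.
  by case: ifP => // _; rewrite geq_min le0 orbT.
apply: contraLR => vNE; rewrite -lt0n /edge_dist.
elim/big_ind: _ => // [a b a0 b0|u uE]; first by rewrite leq_min a0.
by rewrite lt0n dist_eq0; apply: contraNneq vNE => <-.
Qed.

Lemma edge_metric_generatorT : edge_metric_generator [set: G].
Proof.
apply/forall_inP => E1 _; apply/forall_inP => E2 _.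
apply/implyP => neqE; apply/exists_inP.
have /existsP[w wP] : [exists w, (w \in E1) != (w \in E2)].
  apply: contraNT neqE => /existsPn eqE; apply/eqP/setP => w.
  by apply/eqP; rewrite -[_ == _]negbK eqE.
exists w; rewrite ?inE // /distinguishes.
by apply: contraNneq wP => eqd; rewrite -!edge_dist_eq0 eqd.
Qed.

(* The argument of the minimum is well defined by edge_metric_generatorT. *)
Definition edim : nat :=
  #|[arg min_(S < [set: G] | edge_metric_generator S) #|S| ]|.

End EdgeMetricDimension.

(* Algorithms are while-programs for a random access machine with finitely many
   used registers and an indirectly addressed memory, all holding natural
   numbers.  Every elementary operation takes one unit of time.  There is no
   multiplication, so t steps lengthen the binary representation of the stored
   numbers by at most O(t) bits, and polynomial time on this machine is
   polynomial time on a Turing machine. *)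
Inductive expr :=
  | EConst of nat
  | EReg of nat
  | ELoad of expr
  | EAdd of expr & expr
  | ESub of expr & expr.

Inductive cmd :=
  | CSkip
  | CAssign of nat & expr
  | CStore of expr & expr
  | CSeq of cmd & cmd
  | CIf of expr & cmd & cmd
  | CWhile of expr & cmd.

Record state := State { regs : nat -> nat; memory : nat -> nat }.

Fixpoint eval (s : state) (e : expr) : nat :=
  match e with
  | EConst n => n
  | EReg x => regs s x
  | ELoad a => memory s (eval s a)
  | EAdd e1 e2 => eval s e1 + eval s e2
  | ESub e1 e2 => eval s e1 - eval s e2
  end.

Fixpoint ecost (e : expr) : nat :=
  match e with
  | EConst _ | EReg _ => 1
  | ELoad a => (ecost a).+1
  | EAdd e1 e2 | ESub e1 e2 => (ecost e1 + ecost e2).+1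
  end.

(* exec c s t s' : started in s, the program c halts in s' after time t;
   tests succeed on nonzero values. *)
Inductive exec : cmd -> state -> nat -> state -> Prop :=
  | ExecSkip s : exec CSkip s 1 s
  | ExecAssign s x e :
      exec (CAssign x e) s (ecost e).+1
        (State [eta regs s with x |-> eval s e] (memory s))
  | ExecStore s a e :
      exec (CStore a e) s (ecost a + ecost e).+1
        (State (regs s) [eta memory s with eval s a |-> eval s e])
  | ExecSeq s c1 c2 t1 t2 s1 s2 :
      exec c1 s t1 s1 -> exec c2 s1 t2 s2 -> exec (CSeq c1 c2) s (t1 + t2) s2
  | ExecIfT s e c1 c2 t s' :
      eval s e != 0 -> exec c1 s t s' ->
      exec (CIf e c1 c2) s (ecost e + t).+1 s'
  | ExecIfF s e c1 c2 t s' :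
      eval s e = 0 -> exec c2 s t s' ->
      exec (CIf e c1 c2) s (ecost e + t).+1 s'
  | ExecWhileT s e c t1 t2 s1 s2 :
      eval s e != 0 -> exec c s t1 s1 -> exec (CWhile e c) s1 t2 s2 ->
      exec (CWhile e c) s (ecost e + t1 + t2).+1 s2
  | ExecWhileF s e c :
      eval s e = 0 -> exec (CWhile e c) s (ecost e).+1 s.

Lemma exec_det c s t1 s1 t2 s2 :
  exec c s t1 s1 -> exec c s t2 s2 -> t1 = t2 /\ s1 = s2.
Proof.
move=> ex1; elim: ex1 t2 s2 => {c s t1 s1}
  [s|s x e|s a e|s c1 c2 t1 t2 s1 s2 _ IH1 _ IH2|s e c1 c2 t s' e0 _ IH1
  |s e c1 c2 t s' e0 _ IH1|s e c t1 t2 s1 s2 e0 _ IH1 _ IH2|s e c e0] u r ex2;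
  inversion ex2; subst => //;
  repeat match goal with
  | H : is_true (eval ?s ?e != 0), H0 : eval ?s ?e = 0 |- _ =>
      by rewrite H0 in H
  | IH : forall _ _, exec ?c ?s _ _ -> _, H : exec ?c ?s _ _ |- _ =>
      case: (IH _ _ H) => ? ?; subst; clear IH
  end; by [].
Qed.

Definition init_state (w : seq nat) : state := State (fun=> 0) (nth 0 w).

(* The output is read in register 0. *)
Definition computes_within (c : cmd) (w : seq nat) (k t : nat) : Prop :=
  exists t' s', [/\ exec c (init_state w) t' s', regs s' 0 = k & t' <= t].

(* The number of vertices followed by the adjacency matrix, row by row. *)
Definition graph_code (G : sgraph) : seq nat :=
  #|G| :: [seq nat_of_bool (sedge x y) | x <- enum G, y <- enum G].

(* Main.v *)
Require Import Defs.
From HB Require Import structures.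
From mathcomp Require Import all_boot all_order all_algebra.
From mathcomp Require Import all_classical all_reals all_analysis.
From mathcomp Require Import zify fintype finset.
Import numFieldNormedType.Exports.

(** The number [edim G] is the optimum of a set cover instance.  The elements
    to be covered are the quadruples (u, v, x, y) where uv and xy are edges that
    some vertex tells apart, and a vertex w covers those whose two edges have
    different distances to w.  A set of vertices is an edge metric generator
    exactly when it covers all quadruples ([generator_cover]), and the number of
    quadruples is at most (2m)^2 ([card_covered]).

    The greedy algorithm repeatedly takes a vertex for which the covered part
    becomes largest.  If a cover with q vertices exists, one of its members
    covers at least the fraction 1/q of what is still uncovered
    ([cover_gain]), so each step multiplies the uncovered number by at most
    1 - 1/q.  Before the last step something is uncovered.  Hence, if k vertices
    are taken, 1 <= (2m)^2 (1 - 1/q)^(k-1) <= (2m)^2 exp(-(k-1)/q), which is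
    k <= q (1 + ln (2m)^2) ([greedy_inv_pick], [greedy_ratio]).

    To run this on the machine, the algorithm is written in a small language
    whose only control structure is a loop over 0, ..., n-1, with n the number
    of vertices.  Programs of this language always terminate and cost at most a
    polynomial in n ([poly_bounded_cost]), and their compilation to
    while-programs is proved correct once and for all ([compileP]).  What is
    left is the functional correctness of one concrete program: it completes the
    adjacency matrix to the distance matrix level by level ([bfs_round]), then
    performs the greedy choices ([greedy_round]). *)

Set Implicit Arguments.
Unset Strict Implicit.
Unset Printing Implicit Defensive.

(** * Loop programs and their compilation *)

(** Holds the number of vertices throughout, and bounds every loop. *)
Definition r_size := 1.
(** Programs name only registers below this one; the registers from here on
    hold the intermediate values of compiled terms. *)
Definition scratch := 20.

(** Sums over all indices are part of the terms, so that the quantities which the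
    algorithm compares (numbers of covered quadruples, row offsets, bounded
    existential tests) are single terms, whose values are mathematical sums
    instead of the outcome of nested loops. *)
Inductive term :=
  | Const of nat
  | Var of nat
  | Fetch of term
  | Plus of term & term
  | Minus of term & term
  | Cond of term & term & term
  | Sum of nat & term.

Inductive prog :=
  | Assign of nat & term
  | Store of term & term
  | Seq of prog & prog
  | For of nat & prog.

Fixpoint teval (mem r : nat -> nat) (t : term) : nat :=
  match t with
  | Const c => c
  | Var x => r x
  | Fetch a => mem (teval mem r a)
  | Plus a b => teval mem r a + teval mem r b
  | Minus a b => teval mem r a - teval mem r b
  | Cond c a b => if teval mem r c != 0 then teval mem r a else teval mem r b
  | Sum x a => \sum_(i < r r_size) teval mem [eta r with x |-> nat_of_ord i] a
  end.

Definition set_reg x v s := State [eta regs s with x |-> v] (memory s).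

Fixpoint run (p : prog) (s : state) : state :=
  match p with
  | Assign x t => set_reg x (teval (memory s) (regs s) t) s
  | Store a t =>
      State (regs s) [eta memory s with teval (memory s) (regs s) a
                      |-> teval (memory s) (regs s) t]
  | Seq p1 p2 => run p2 (run p1 s)
  | For x q => iteri (regs s r_size) (fun i s' => run q (set_reg x i s')) s
  end.

Definition count_loop x body :=
  CSeq (CAssign x (EConst 0))
       (CWhile (ESub (EReg r_size) (EReg x))
          (CSeq body (CAssign x (EAdd (EReg x) (EConst 1))))).

(** The result goes to register [r]; only the registers from [r] on and the
    bound variables of [t] are changed. *)
Fixpoint compile_term (r : nat) (t : term) : cmd :=
  match t with
  | Const c => CAssign r (EConst c)
  | Var x => CAssign r (EReg x)
  | Fetch a => CSeq (compile_term r a) (CAssign r (ELoad (EReg r)))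
  | Plus a b =>
      CSeq (CSeq (compile_term r a) (compile_term r.+1 b))
           (CAssign r (EAdd (EReg r) (EReg r.+1)))
  | Minus a b =>
      CSeq (CSeq (compile_term r a) (compile_term r.+1 b))
           (CAssign r (ESub (EReg r) (EReg r.+1)))
  | Cond c a b =>
      CSeq (compile_term r c)
           (CIf (EReg r) (compile_term r a) (compile_term r b))
  | Sum x a =>
      CSeq (CAssign r (EConst 0))
           (count_loop x (CSeq (compile_term r.+1 a)
                               (CAssign r (EAdd (EReg r) (EReg r.+1)))))
  end.

Fixpoint compile (p : prog) : cmd :=
  match p with
  | Assign x t => CSeq (compile_term scratch t) (CAssign x (EReg scratch))
  | Store a t =>
      CSeq (CSeq (compile_term scratch a) (compile_term scratch.+1 t))
           (CStore (EReg scratch) (EReg scratch.+1))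
  | Seq p1 p2 => CSeq (compile p1) (compile p2)
  | For x q => count_loop x (compile q)
  end.

(** The scope [sc] lists the registers that may be read.  A bound variable must be
    outside of it, since the compiled loop overwrites that register and does not
    restore it. *)
Fixpoint wf_term (sc : seq nat) (t : term) : bool :=
  match t with
  | Const _ => true
  | Var x => x \in sc
  | Fetch a => wf_term sc a
  | Plus a b | Minus a b => wf_term sc a && wf_term sc b
  | Cond c a b => [&& wf_term sc c, wf_term sc a & wf_term sc b]
  | Sum x a => [&& x \notin sc, x < scratch & wf_term (x :: sc) a]
  end.

(** The list [av] of assignable registers will be required to omit [r_size], and
    loop counters are kept out of it because they are new to a scope that
    contains it; hence no loop body disturbs its own counter or bound. *)
Fixpoint wf (av sc : seq nat) (p : prog) : bool :=
  match p with
  | Assign x t => (x \in av) && wf_term sc t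
  | Store a t => wf_term sc a && wf_term sc t
  | Seq p1 p2 => wf av sc p1 && wf av sc p2
  | For x q => [&& x \notin sc, x < scratch & wf av (x :: sc) q]
  end.

(** Both branches of a conditional are charged, which keeps the bound a function
    of [n] alone. *)
Fixpoint term_cost (n : nat) (t : term) : nat :=
  match t with
  | Const _ | Var _ => 2
  | Fetch a => term_cost n a + 3
  | Plus a b | Minus a b => term_cost n a + term_cost n b + 4
  | Cond c a b => term_cost n c + (term_cost n a + term_cost n b + 2)
  | Sum x a => n * (term_cost n a + 12) + 8
  end.

Fixpoint cost (n : nat) (p : prog) : nat :=
  match p with
  | Assign x t => term_cost n t + 2
  | Store a t => term_cost n a + term_cost n t + 3
  | Seq p1 p2 => cost n p1 + cost n p2
  | For x q => n * (cost n q + 8) + 6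
  end.

Lemma teval_agree mem sc r1 r2 t : wf_term sc t -> r_size \in sc ->
  {in sc, r1 =1 r2} -> teval mem r1 t = teval mem r2 t.
Proof.
elim: t sc r1 r2 => [c|x|a IHa|a IHa b IHb|a IHa b IHb|c IHc a IHa b IHb|x a IHa]
  sc r1 r2 /=.
- by [].
- by move=> xsc _; apply.
- by move=> wa Nsc E; rewrite (IHa sc r1 r2).
- by case/andP=> wa wb Nsc E; rewrite (IHa sc r1 r2) ?(IHb sc r1 r2).
- by case/andP=> wa wb Nsc E; rewrite (IHa sc r1 r2) ?(IHb sc r1 r2).
- by case/and3P=> wc wa wb Nsc E;
    rewrite (IHc sc r1 r2) ?(IHa sc r1 r2) ?(IHb sc r1 r2).
case/and3P=> xsc _ wa Nsc E; rewrite E //; apply: eq_bigr => i _.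
apply: IHa wa _ _; first by rewrite inE Nsc orbT.
by move=> y; rewrite inE /=; case: eqP => //= _ /E.
Qed.

(** The invariant [I i] describes the state in which the counter [x] has just
    been set to [i]; it is up to the body to leave the counter alone. *)
Lemma exec_count_loop x body n T (I : nat -> state -> Prop) s :
  (forall i s', i < n -> I i s' -> regs s' x = i -> exists u s1,
     [/\ exec body s' u s1, u <= T, regs s1 x = i
       & I i.+1 (set_reg x i.+1 s1)]) ->
  (forall i s', I i s' -> regs s' r_size = n) ->
  I 0 (set_reg x 0 s) ->
  exists u s1, [/\ exec (count_loop x body) s u s1, u <= n * (T + 8) + 6
    & I n s1].
Proof.
move=> step IN I0.
suff loop i s' : i <= n -> I i s' -> regs s' x = i -> exists u s1,
    [/\ exec (CWhile (ESub (EReg r_size) (EReg x))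
          (CSeq body (CAssign x (EAdd (EReg x) (EConst 1))))) s' u s1,
        u <= (n - i) * (T + 8) + 4 & I n s1].
  have [|u [s1 [ex le_u In]]] := loop 0 _ (leq0n n) I0; first by rewrite /= eqxx.
  exists (2 + u), s1; split => //; last by move: le_u; rewrite subn0; lia.
  exact: ExecSeq (ExecAssign s x (EConst 0)) ex.
move=> le_in; have [d def_d] : exists d, d = n - i by exists (n - i).
rewrite -def_d; elim: d i s' le_in def_d => [|d IHd] i s' le_in def_d Ii xi.
  have def_i : i = n by lia.
  exists 4, s'; split; rewrite ?add0n ?mul0n //; last by rewrite -def_i.
  by apply: ExecWhileF; rewrite /= (IN _ _ Ii) xi def_i subnn.
have lt_in : i < n by lia.
have [u [s1 [ex le_u x1 I1]]] := step i s' lt_in Ii xi.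
have [||||u2 [s2 [ex2 le_u2 In]]] := IHd i.+1 (set_reg x i.+1 s1).
- by [].
- by lia.
- by [].
- by rewrite /= eqxx.
exists (3 + (u + 4) + u2).+1, s2; split => //; last by lia.
apply: (ExecWhileT (s1 := set_reg x i.+1 s1)) ex2.
  by rewrite /= (IN _ _ Ii) xi; lia.
apply: ExecSeq ex _.
by rewrite -(addn1 i) -[in set_reg _ _]x1; apply: ExecAssign.
Qed.

(** The registers that the evaluation of a term into [r] has to preserve: the
    program's own ones and the intermediate results still waiting below [r]. *)
Definition kept (sc : seq nat) r y := (y \in sc) || (scratch <= y < r).

Lemma keptS sc r y : kept sc r y -> kept sc r.+1 y.
Proof. by rewrite /kept; case: (y \in sc) => //= /andP[-> /leqW ->]. Qed.

Lemma kept_neq sc r y : all (gtn scratch) sc -> scratch <= r ->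
  kept sc r y -> (y == r) = false.
Proof.
move=> /allP lt_sc le_r; case: eqP => // ->.
by rewrite /kept ltnn andbF orbF => /lt_sc; rewrite [gtn _ _]ltnNge le_r.
Qed.

Lemma compile_termP t sc r s :
  wf_term sc t -> all (gtn scratch) sc -> r_size \in sc -> scratch <= r ->
  exists u s', [/\ exec (compile_term r t) s u s',
    u <= term_cost (regs s r_size) t, memory s' = memory s,
    regs s' r = teval (memory s) (regs s) t
    & forall y, kept sc r y -> regs s' y = regs s y].
Proof.
elim: t sc r s => [c|x|a IHa|a IHa b IHb|a IHa b IHb|c IHc a IHa b IHb|x a IHa]
  sc r s wft lt_sc Nsc le_r.
- exists 2, (set_reg r c s); split=> //=; first exact: ExecAssign.
    by rewrite eqxx.
  by move=> y /kept_neq ->.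
- exists 2, (set_reg r (regs s x) s); split=> //=; first exact: ExecAssign.
    by rewrite eqxx.
  by move=> y /kept_neq ->.
- have [u [s1 [ex le_u m1 v1 f1]]] := IHa sc r s wft lt_sc Nsc le_r.
  exists (u + 3), (set_reg r (memory s1 (regs s1 r)) s1); split=> //=.
  + exact: ExecSeq ex (ExecAssign s1 r (ELoad (EReg r))).
  + by rewrite leq_add2r.
  + by rewrite eqxx v1 m1.
  + by move=> y yk; rewrite (kept_neq _ _ yk) // f1.
- case/andP: wft => wa wb.
  have [u [s1 [ex le_u m1 v1 f1]]] := IHa sc r s wa lt_sc Nsc le_r.
  have [u2 [s2 [ex2 le_u2 m2 v2 f2]]] :=
    IHb sc r.+1 s1 wb lt_sc Nsc (leqW le_r).
  have N1 : regs s1 r_size = regs s r_size by rewrite f1 // /kept Nsc.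
  exists (u + u2 + 4), (set_reg r (regs s2 r + regs s2 r.+1) s2); split=> //=.
  + exact: ExecSeq (ExecSeq ex ex2) (ExecAssign s2 r (EAdd (EReg r) (EReg r.+1))).
  + by rewrite leq_add2r leq_add // -N1.
  + by rewrite m2.
  + rewrite eqxx v2 f2 ?v1 /kept ?le_r ?leqnn ?orbT // m1.
    by congr (_ + _); apply: teval_agree wb Nsc _ => y ysc; rewrite f1 // /kept ysc.
  + by move=> y yk; rewrite (kept_neq _ _ yk) // f2 ?f1 // keptS.
- case/andP: wft => wa wb.
  have [u [s1 [ex le_u m1 v1 f1]]] := IHa sc r s wa lt_sc Nsc le_r.
  have [u2 [s2 [ex2 le_u2 m2 v2 f2]]] :=
    IHb sc r.+1 s1 wb lt_sc Nsc (leqW le_r).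
  have N1 : regs s1 r_size = regs s r_size by rewrite f1 // /kept Nsc.
  exists (u + u2 + 4), (set_reg r (regs s2 r - regs s2 r.+1) s2); split=> //=.
  + exact: ExecSeq (ExecSeq ex ex2) (ExecAssign s2 r (ESub (EReg r) (EReg r.+1))).
  + by rewrite leq_add2r leq_add // -N1.
  + by rewrite m2.
  + rewrite eqxx v2 f2 ?v1 /kept ?le_r ?leqnn ?orbT // m1.
    by congr (_ - _); apply: teval_agree wb Nsc _ => y ysc; rewrite f1 // /kept ysc.
  + by move=> y yk; rewrite (kept_neq _ _ yk) // f2 ?f1 // keptS.
- case/and3P: wft => wc wa wb.
  have [u [s1 [ex le_u m1 v1 f1]]] := IHc sc r s wc lt_sc Nsc le_r.
  have N1 : regs s1 r_size = regs s r_size by rewrite f1 // /kept Nsc.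
  have agree t : wf_term sc t ->
    teval (memory s1) (regs s1) t = teval (memory s) (regs s) t.
    by move=> wt; rewrite m1; apply: teval_agree wt Nsc _ => y ysc;
      rewrite f1 // /kept ysc.
  case: (eqVneq (regs s1 r) 0) => [r0|rn0].
  + have [u2 [s2 [ex2 le_u2 m2 v2 f2]]] := IHb sc r s1 wb lt_sc Nsc le_r.
    exists (u + (1 + u2).+1), s2; split=> /=.
    * by apply: ExecSeq ex _; apply: ExecIfF (EReg r) _ _ _ _ _ _.
    * by rewrite N1 in le_u2; lia.
    * by rewrite m2.
    * by rewrite -v1 r0 eqxx v2 agree.
    * by move=> y yk; rewrite f2 // f1.
  + have [u2 [s2 [ex2 le_u2 m2 v2 f2]]] := IHa sc r s1 wa lt_sc Nsc le_r.
    exists (u + (1 + u2).+1), s2; split=> /=.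
    * by apply: ExecSeq ex _; apply: ExecIfT (EReg r) _ _ _ _ _ _.
    * by rewrite N1 in le_u2; lia.
    * by rewrite m2.
    * by rewrite -v1 rn0 v2 agree.
    * by move=> y yk; rewrite f2 // f1.
case/and3P: wft => xsc lt_x wa.
have Nx : (r_size == x) = false by apply: contraNF xsc => /eqP <-.
have xr : (x == r) = false by lia.
have rx : (r == x) = false by lia.
pose F i := teval (memory s) [eta regs s with x |-> i] a.
pose I (i : nat) (s' : state) := [/\ memory s' = memory s,
  regs s' r = \sum_(j < i) F j
  & forall y, y != x -> kept sc r y -> regs s' y = regs s y].
have NI i s' : I i s' -> regs s' r_size = regs s r_size.
  by case=> _ _ -> //; rewrite ?Nx // /kept Nsc.
have [|| u [s1 [ex le_u [m1 v1 f1]]]] := @exec_count_loop x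
  (CSeq (compile_term r.+1 a) (CAssign r (EAdd (EReg r) (EReg r.+1))))
  (regs s r_size) (term_cost (regs s r_size) a + 4) I (set_reg r 0 s) _ NI.
- move=> i s' lt_in Ii xi.
  have [m' v' f'] := Ii.
  have [|||u [s1 [ex le_u m1 v1 f1]]] := IHa (x :: sc) r.+1 s' wa.
  + by rewrite /= lt_x.
  + by rewrite inE Nsc orbT.
  + exact: leqW.
  exists (u + 4), (set_reg r (regs s1 r + regs s1 r.+1) s1); split=> //=.
  + exact: ExecSeq ex (ExecAssign s1 r (EAdd (EReg r) (EReg r.+1))).
  + by rewrite leq_add2r -(NI _ _ Ii).
  + by rewrite xr f1 // /kept inE eqxx.
  split=> //=; first by rewrite m1.
    rewrite rx eqxx big_ord_recr /= v1 f1 /kept ?le_r ?leqnn ?orbT // v' m'.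
    congr (_ + _); apply: teval_agree wa _ _; first by rewrite inE Nsc orbT.
    move=> y; rewrite inE /=; case: eqP => [->|/eqP yx] //= ysc.
    by rewrite f' // /kept ysc.
  move=> y yx yk; rewrite (negPf yx) (kept_neq _ _ yk) // f1 ?f' //.
  by rewrite keptS // /kept inE (negPf yx).
- split=> //=; first by rewrite rx eqxx big_ord0.
  by move=> y yx yk; rewrite (negPf yx) (kept_neq _ _ yk).
exists (2 + u), s1; split=> //.
- exact: ExecSeq (ExecAssign s r (EConst 0)) ex.
- by move: le_u => /=; lia.
move=> y yk; case: (eqVneq y x) => [yx|yx]; last exact: f1.
by move: yk; rewrite yx /kept (negPf xsc) /=; lia.
Qed.

(** The induction principle for loops at the level of [run]. *)
Lemma iteri_inv (A : Type) n (f : nat -> A -> A) (P : nat -> A -> Prop) a :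
  (forall i b, i < n -> P i b -> P i.+1 (f i b)) -> P 0 a -> P n (iteri n f a).
Proof.
move=> step P0; elim: n step => [|n IHn] step //=.
by apply: (step) => //; apply: IHn => i b lt_in; apply: step; apply: ltnW.
Qed.

Lemma run_frame av sc p s y : wf av sc p -> y \in sc -> y \notin av ->
  regs (run p s) y = regs s y.
Proof.
move=> wp ysc yav.
elim: p sc s wp ysc => [x t|a t|p1 IH1 p2 IH2|x q IHq] sc s //=.
- by case/andP=> xav _ _; case: eqP yav => [->|//]; rewrite xav.
- by case/andP=> w1 w2 ysc; rewrite (IH2 sc) // (IH1 sc).
case/and3P=> xsc _ wq ysc.
apply: (@iteri_inv _ _ _ (fun _ s' => regs s' y = regs s y)) => // i s' _ <-.
rewrite (IHq (x :: sc)) //=; last by rewrite inE ysc orbT.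
by case: eqP xsc => [<-|//]; rewrite ysc.
Qed.

(** Only agreement on the scope can be claimed: after a loop the counter of the
    compiled program holds the loop bound, while [run] leaves the last index in
    it. *)
Lemma compileP av p sc s h :
  wf av sc p -> all (gtn scratch) sc -> r_size \in sc -> r_size \notin av ->
  {subset av <= sc} -> memory s = memory h -> {in sc, regs s =1 regs h} ->
  exists u s', [/\ exec (compile p) s u s', u <= cost (regs h r_size) p,
    memory s' = memory (run p h) & {in sc, regs s' =1 regs (run p h)}].
Proof.
move=> wp lt_sc Nsc Nav av_sc; elim: p sc s h wp lt_sc Nsc av_sc
  => [x t|a t|p1 IH1 p2 IH2|x q IHq] sc s h wp lt_sc Nsc av_sc em er /=.
- case/andP: wp => xav wt.
  have [u [s1 [ex le_u m1 v1 f1]]] := compile_termP s wt lt_sc Nsc (leqnn _).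
  exists (u + 2), (set_reg x (regs s1 scratch) s1); split=> //=.
  + exact: ExecSeq ex (ExecAssign s1 x (EReg scratch)).
  + by rewrite leq_add2r -er.
  + by rewrite m1.
  move=> y ysc /=; rewrite v1 em (teval_agree _ wt Nsc er) f1 ?er //.
  by rewrite /kept ysc.
- case/andP: wp => wa wt.
  have [u [s1 [ex le_u m1 v1 f1]]] := compile_termP s wa lt_sc Nsc (leqnn _).
  have [u2 [s2 [ex2 le_u2 m2 v2 f2]]] :=
    compile_termP s1 wt lt_sc Nsc (leqnSn scratch).
  have E1 : {in sc, regs s1 =1 regs h}.
    by move=> y ysc; rewrite f1 ?er // /kept ysc.
  exists (u + u2 + 3), (State (regs s2)
     [eta memory s2 with regs s2 scratch |-> regs s2 scratch.+1]); split=> //=.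
  + exact: ExecSeq (ExecSeq ex ex2)
      (ExecStore s2 (EReg scratch) (EReg scratch.+1)).
  + by rewrite leq_add2r leq_add // ?(leq_trans le_u) ?(leq_trans le_u2) ?E1 ?er.
  + have -> : regs s2 scratch = teval (memory h) (regs h) a.
      by rewrite f2 ?v1 ?em ?(teval_agree _ wa Nsc er) // /kept ltnSn leqnn orbT.
    by rewrite v2 m2 m1 em (teval_agree _ wt Nsc E1).
  + by move=> y ysc; rewrite f2 ?E1 // /kept ysc.
- case/andP: wp => w1 w2.
  have [u [s1 [ex le_u m1 f1]]] := IH1 sc s h w1 lt_sc Nsc av_sc em er.
  have [u2 [s2 [ex2 le_u2 m2 f2]]] := IH2 sc s1 _ w2 lt_sc Nsc av_sc m1 f1.
  exists (u + u2), s2; split=> //; first exact: ExecSeq ex ex2.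
  by rewrite leq_add // -(run_frame h w1 Nsc Nav).
case/and3P: wp => xsc lt_x wq.
have Nx : (r_size == x) = false by apply: contraNF xsc => /eqP <-.
set n := regs h r_size.
pose H i := iteri i (fun i s' => run q (set_reg x i s')) h.
have NH i : regs (H i) r_size = n.
  apply: (@iteri_inv _ _ _ (fun _ s' => regs s' r_size = n)) => // j s' _ <-.
  by rewrite (run_frame _ wq) //= ?Nx // inE Nsc orbT.
pose I (i : nat) (s' : state) :=
  memory s' = memory (H i) /\ {in sc, regs s' =1 regs (H i)}.
have NI i s' : I i s' -> regs s' r_size = n by case=> _ ->.
have [||u [s1 [ex le_u [m1 f1]]]] :=
    @exec_count_loop x (compile q) n (cost n q) I s _ NI; last by exists u, s1.
  move=> i s' lt_in [m' f'] xi.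
  have [|||||u [s1 [ex le_u m1 f1]]] :=
      IHq (x :: sc) s' (set_reg x i (H i)) wq.
  + by rewrite /= lt_x.
  + by rewrite inE Nsc orbT.
  + by move=> y /av_sc ysc; rewrite inE ysc orbT.
  + by [].
  + by move=> y; rewrite inE /=; case: eqP => [->|] //= _; apply: f'.
  exists u, s1; split=> //; first by move: le_u; rewrite /= Nx NH.
    rewrite f1 ?inE ?eqxx // (run_frame _ wq) ?inE ?eqxx //=; first by rewrite eqxx.
    by apply: contra xsc; apply: av_sc.
  split=> // y ysc /=.
  rewrite ifF; first by rewrite f1 // inE ysc orbT.
  by apply: contraNF xsc => /eqP <-.
split=> // y ysc /=; rewrite ifF ?er //.
by apply: contraNF xsc => /eqP <-.
Qed.

(** Powers of [n.+1] rather than [n], so that any degree may be raised, also for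
    [n = 0]. *)
Definition poly_bounded (f : nat -> nat) :=
  exists a d, forall n, f n <= a * n.+1 ^ d.

Lemma poly_bounded_const c : poly_bounded (fun=> c).
Proof. by exists c, 0 => n; rewrite expn0 muln1. Qed.

Lemma poly_boundedD f g :
  poly_bounded f -> poly_bounded g -> poly_bounded (fun n => f n + g n).
Proof.
move=> [a [d fP]] [b [e gP]]; exists (a + b), (d + e) => n.
rewrite mulnDl; apply: leq_add.
  by apply: leq_trans (fP n) _; rewrite leq_mul2l leq_pexp2l ?leq_addr ?orbT.
by apply: leq_trans (gP n) _; rewrite leq_mul2l leq_pexp2l ?leq_addl ?orbT.
Qed.

Lemma poly_boundedM f :
  poly_bounded f -> poly_bounded (fun n => n * f n).
Proof.
move=> [a [d fP]]; exists a, d.+1 => n.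
by rewrite expnS mulnCA leq_mul.
Qed.

Lemma poly_bounded_term_cost t : poly_bounded (term_cost^~ t).
Proof.
elim: t => [c|x|a IHa|a IHa b IHb|a IHa b IHb|c IHc a IHa b IHb|x a IHa] /=;
by repeat first [assumption | exact: poly_bounded_const
                | apply: poly_boundedD | apply: poly_boundedM].
Qed.

Lemma poly_bounded_cost p : poly_bounded (cost^~ p).
Proof.
elim: p => [x t|a t|p1 IH1 p2 IH2|x q IHq] /=;
by repeat first [assumption | exact: poly_bounded_const
     | exact: poly_bounded_term_cost | apply: poly_boundedD | apply: poly_boundedM].
Qed.

(** * Greedy set cover *)

Section GreedyCover.
Variables (V T : finType) (d : V -> T -> bool).
Implicit Types S Q : {set V}.

Definition covered S : {set T} := [set t | [exists w in S, d w t]].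

Lemma coveredS S1 S2 : S1 \subset S2 -> covered S1 \subset covered S2.
Proof.
move=> sS; apply/subsetP=> t; rewrite !inE => /exists_inP[w wS wt].
by apply/exists_inP; exists w => //; apply: (subsetP sS).
Qed.

(** What [S] leaves uncovered is covered by the members of [Q], and a single one
    of them adds at most [b - #|covered S|] elements. *)
Lemma cover_gain Q S b :
  covered Q = covered [set: V] -> (forall w, #|covered (w |: S)| <= b) ->
  #|covered [set: V]| - #|covered S| <= #|Q| * (b - #|covered S|).
Proof.
move=> QU maxb; rewrite -QU -sum_nat_const.
have sub w : covered S \subset covered (w |: S) by apply/coveredS/subsetUr.
apply: leq_trans (_ : #|\bigcup_(w in Q) (covered (w |: S) :\: covered S)| <= _).
  rewrite leq_subLR -leq_subLR; apply: leq_trans (_ : #|covered Q :\: covered S| <= _).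
    by rewrite cardsD leq_sub2l // subset_leq_card // subsetIr.
  apply/subset_leq_card/subsetP=> t; rewrite !inE => /andP[tS /exists_inP[w wQ wt]].
  apply/bigcupP; exists w => //; rewrite !inE tS; apply/exists_inP.
  by exists w => //; rewrite setU11.
elim/big_rec2: _ => [|w m A wQ le_A]; first by rewrite cards0.
apply: leq_trans (leq_card_setU _ _) _; rewrite leq_add //.
by rewrite cardsD (setIidPr (sub w)) leq_sub2r.
Qed.

(** After [i] rounds, with [q] the size of some cover.  The second clause says
    that the uncovered number is at most u (1 - 1/q)^|S|, cleared of
    denominators.  The third clause is this bound before the last choice, where
    at least one element was uncovered; it is the one that limits the size of
    [S].  The first clause makes [S] a cover after as many rounds as there are
    vertices: either everything is covered, or every round added a vertex. *)
Definition greedy_inv (q i : nat) S :=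
  let u := #|covered [set: V]| in
  [/\ #|covered S| = u \/ i <= #|S|,
      (u - #|covered S|) * q ^ #|S| <= u * q.-1 ^ #|S|
    & 0 < #|S| -> 0 < q /\ q ^ #|S|.-1 <= u * q.-1 ^ #|S|.-1].

Lemma greedy_inv0 q : greedy_inv q 0 set0.
Proof. by split; rewrite ?cards0 ?expn0 ?muln1 ?leq_subr //; right. Qed.

(** If no vertex improves, [cover_gain] leaves nothing uncovered. *)
Lemma greedy_inv_stop Q i S : covered Q = covered [set: V] ->
  (forall w, #|covered (w |: S)| <= #|covered S|) ->
  greedy_inv #|Q| i S -> greedy_inv #|Q| i.+1 S.
Proof.
move=> QU /(cover_gain QU) gain [_ inv1 inv2]; split => //; left.
apply/eqP; rewrite eqn_leq subset_leq_card ?coveredS ?subsetT //=.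
by move: gain; rewrite subnn muln0 leqn0 subn_eq0.
Qed.

(** By [cover_gain] the uncovered numbers r and r' before and after the choice
    satisfy r <= q (r - r'), that is, q r' <= (q - 1) r. *)
Lemma greedy_inv_pick Q i S w : covered Q = covered [set: V] ->
  (forall w', #|covered (w' |: S)| <= #|covered (w |: S)|) ->
  #|covered S| < #|covered (w |: S)| ->
  greedy_inv #|Q| i S -> greedy_inv #|Q| i.+1 (w |: S).
Proof.
move=> QU /(cover_gain QU) gain lt_cov [inv0 inv1 inv2].
have wS : w \notin S.
  by apply: contraL lt_cov => wS; rewrite (setUidPr _) ?ltnn // sub1set.
have le_u : #|covered (w |: S)| <= #|covered [set: V]|.
  by rewrite subset_leq_card // coveredS // subsetT.
rewrite /greedy_inv cardsU1 wS add1n /=.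
move: gain lt_cov le_u inv0 inv1 {inv2}.
set u := #|covered [set: V]|; set c := #|covered S|; set c' := #|covered (w |: S)|.
set k := #|S|; set q := #|Q| => gain lt_c le_u inv0 inv1.
have q_gt0 : 0 < q by case: q gain {inv1} => // ; rewrite mul0n; lia.
split; first by right; case: inv0 => [|//]; lia.
- have step : (u - c') * q <= (u - c) * q.-1 by nia.
  rewrite !expnS mulnA (leq_trans (leq_mul step (leqnn _))) //.
  by rewrite mulnAC [u * _]mulnCA mulnC leq_mul2l inv1 orbT.
move=> _; split=> //; apply: leq_trans inv1.
by rewrite -[X in X <= _]mul1n leq_mul2r; apply/orP; right; lia.
Qed.

Lemma greedy_inv_full q S : greedy_inv q #|V| S -> covered S = covered [set: V].
Proof.
case=> [[/eqP cov|full] _ _].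
  by apply/eqP; rewrite eqEcard coveredS ?subsetT //= (eqP cov).
congr covered; apply/eqP; rewrite eqEcard subsetT /=.
by rewrite cardsT.
Qed.
End GreedyCover.

(** * Distances in a connected graph *)

(** The generic lemmas on iterated operations then apply to [edge_dist]. *)
HB.instance Definition _ := SemiGroup.isComLaw.Build nat minn minnA minnC.

Section Distances.
Variable G : sgraph.

Lemma distP (x y : G) k : k < #|G| ->
  reflect (exists p, [/\ path (@sedge G) x p, last x p = y & size p <= k])
          (dist x y <= k).
Proof.
move=> lt_k; apply: (iffP idP) => [le_k|[p [xp lp le_p]]].
  have lt_n : dist x y < size (iota 0 #|G|).
    by rewrite size_iota (leq_ltn_trans le_k).
  have /(nth_find 0) : has (fun k => [exists p : k.-tuple G,
      [&& path (@sedge G) x p, last x p == y & uniq (x :: p)]]) (iota 0 #|G|).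
    by rewrite has_find.
  rewrite -/(dist x y) nth_iota ?(leq_ltn_trans le_k) // add0n.
  by case/existsP=> p /and3P[xp /eqP lp _]; exists p; rewrite size_tuple.
case/shortenP: xp lp => p' xp' up' sub_p lp.
have le_p' : size p' <= size p.
  by apply: uniq_leq_size => [|z /sub_p //]; case/andP: up'.
apply: leq_trans (leq_trans le_p' le_p); rewrite leqNgt; apply/negP.
move/(before_find 0); rewrite nth_iota; last by lia.
move/existsP; case; exists (in_tuple p').
by rewrite xp' lp eqxx up'.
Qed.

Lemma dist_edge (x y : G) : sedge x y -> dist x y = 1.
Proof.
move=> xy; have xNy : x != y by apply: contraL xy => /eqP <-; rewrite sedge_irrefl.
have lt1 : 1 < #|G| by rewrite (cardD1 x) (cardD1 y) !inE eq_sym xNy.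
apply/eqP; rewrite eqn_leq lt0n dist_eq0 xNy andbT.
by apply/distP => //; exists [:: y]; rewrite /= xy.
Qed.

Hypothesis connG : connected_graph G.

Lemma dist_lt (x y : G) : dist x y < #|G|.
Proof.
have [G_gt0 /(_ x y)/connectP[p xp lp]] := connG.
case/shortenP: xp lp => p' xp' up' _ lp'.
have lt_p' : size p' < #|G|.
  by have /= := max_card (mem (x :: p')); rewrite (card_uniqP up').
apply: leq_ltn_trans (lt_p'); apply/distP => //; exists p'.
by rewrite -lp'.
Qed.

Lemma dist_step (x y z : G) : sedge y z -> dist x z <= (dist x y).+1.
Proof.
move=> yz; case: (ltnP (dist x y).+1 #|G|) => [lt|]; last first.
  by apply: leq_trans; apply/ltnW/dist_lt.
have /distP-/(_ (ltnW lt))[p [xp lp le_p]] := leqnn (dist x y).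
by apply/distP => //; exists (rcons p z); rewrite rcons_path last_rcons xp lp size_rcons.
Qed.

(** This is what makes the level-by-level computation of distances complete:
    the vertex before the last one on a shortest path lies one level lower. *)
Lemma dist_pred (x z : G) k : dist x z = k.+1 ->
  exists2 y, dist x y = k & sedge y z.
Proof.
move=> xz; have lt_k := dist_lt x z; rewrite xz in lt_k.
have /distP-/(_ lt_k)[p] : dist x z <= k.+1 by rewrite xz.
case/lastP: p => [|p z'] [].
  by move=> _ /= /eqP; rewrite -dist_eq0 xz.
rewrite rcons_path last_rcons size_rcons => /andP[xp yz] zz' le_p.
rewrite zz' in yz; exists (last x p) => //.
apply/eqP; rewrite eqn_leq; apply/andP; split.
  by apply/distP; [exact: ltnW | exists p].
by rewrite -ltnS -xz; apply: dist_step.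
Qed.

Lemma dist_eq1 (x y : G) : (dist x y == 1) = sedge x y.
Proof.
apply/eqP/idP => [/dist_pred[x' /eqP]|]; last exact: dist_edge.
by rewrite dist_eq0 => /eqP <-.
Qed.

Lemma edge_dist2 (u v w : G) : sedge u v ->
  edge_dist [set u; v] w = minn (dist u w) (dist v w).
Proof.
move=> uv; rewrite /edge_dist (bigD1 u) ?set21 //=; congr minn.
rewrite (@big_pred1_id _ _ _ _ v) => [|x].
  exact/minn_idPl/ltnW/dist_lt.
rewrite !inE; case: (eqVneq x u) => //= [->|_]; last by rewrite andbT.
by apply/esym; apply: contraTF uv => /eqP <-; rewrite sedge_irrefl.
Qed.

End Distances.

(** * Edge metric generators as covers *)

Section Cover.
Variable G : sgraph.

(** An unordered pair of edges is represented by several quadruples of vertices,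
    which is harmless for covers and spares the program a normal form. *)
Definition separates (w : G) (t : (G * G) * (G * G)) : bool :=
  [&& sedge t.1.1 t.1.2, sedge t.2.1 t.2.2
    & distinguishes w [set t.1.1; t.1.2] [set t.2.1; t.2.2]].

Lemma in_covered S u v x y :
  (((u, v), (x, y)) \in covered separates S) =
  [&& sedge u v, sedge x y & [exists w in S, distinguishes w [set u; v] [set x; y]]].
Proof.
rewrite inE; apply/exists_inP/and3P => [[w wS /and3P[uv xy dw]]|[uv xy]].
  by split=> //; apply/exists_inP; exists w.
by case/exists_inP=> w wS dw; exists w => //; apply/and3P.
Qed.

(** The quadruples covered by all vertices together are those with two distinct
    edges, because distinct edges are separated by an end of one of them
    ([edge_metric_generatorT]). *)
Lemma generator_cover S :
  edge_metric_generator S = (covered separates S == covered separates [set: G]).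
Proof.
apply/idP/eqP => [gS|cov].
  apply/eqP; rewrite eqEsubset coveredS ?subsetT //=.
  apply/subsetP=> [[[u v] [x y]]]; rewrite !inE => /exists_inP[w _ /and3P[/= uv xy dw]].
  have edge a b : sedge a b -> [set a; b] \in edges G.
    by move=> ab; apply/imset2P; exists a b; rewrite ?inE.
  have neq : [set u; v] != [set x; y].
    by apply: contraTneq dw => ->; rewrite /distinguishes eqxx.
  have /exists_inP[w' w'S dw'] :=
    implyP (forall_inP (forall_inP gS _ (edge _ _ uv)) _ (edge _ _ xy)) neq.
  by apply/exists_inP; exists w'; rewrite // /separates uv xy.
apply/forall_inP=> E1 E1G; apply/forall_inP=> E2 E2G; apply/implyP=> neq.
have /forall_inP/(_ _ E1G)/forall_inP/(_ _ E2G)/implyP/(_ neq) :=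
  edge_metric_generatorT G.
case/exists_inP=> w _ dw.
case/imset2P: E1G => u v _; rewrite inE => uv def1.
case/imset2P: E2G => x y _; rewrite inE => xy def2.
have : ((u, v), (x, y)) \in covered separates S.
  rewrite cov inE; apply/exists_inP; exists w; rewrite ?inE // /separates /=.
  by case/andP: uv => _ ->; case/andP: xy => _ ->; rewrite -def1 -def2.
rewrite inE => /exists_inP[w' w'S /and3P[/= _ _ dw']].
by apply/exists_inP; exists w'; rewrite // def1 def2.
Qed.

(** An edge has two orientations, which the numbering of the vertices tells
    apart. *)
Lemma card_darts : #|[set p : G * G | sedge p.1 p.2]| <= #|edges G| * 2.
Proof.
pose f (p : G * G) := ([set p.1; p.2], enum_rank p.1 < enum_rank p.2).
have inj_f : {in [set p : G * G | sedge p.1 p.2] &, injective f}.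
  move=> [a b] [c d]; rewrite !inE /= => ab cd [/setP eq_set eq_lt].
  have neq x y : sedge x y -> x != y :> G.
    by move=> xy; apply: contraL xy => /eqP <-; rewrite sedge_irrefl.
  have := eq_set a; rewrite !inE eqxx /= => /esym/orP[] /eqP Ea.
    have := eq_set b; rewrite !inE eqxx orbT => /esym/orP[] /eqP Eb.
      by have := neq _ _ ab; rewrite Ea Eb eqxx.
    by rewrite Ea Eb.
  have := eq_set b; rewrite !inE eqxx orbT => /esym/orP[] /eqP Eb; last first.
    by have := neq _ _ ab; rewrite Ea Eb eqxx.
  have : enum_rank a != enum_rank b by rewrite (inj_eq enum_rank_inj) neq.
  by rewrite -val_eqE /=; move: eq_lt; rewrite Ea Eb; case: ltngtP.
rewrite -[leqLHS](card_in_imset inj_f) -card_bool -cardsT -cardsX.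
apply/subset_leq_card/subsetP=> p /imsetP[[a b]]; rewrite inE /= => ab ->.
by rewrite !inE andbT; apply/imset2P; exists a b; rewrite ?inE.
Qed.

Lemma card_covered S : #|covered separates S| <= (#|edges G| * 2) ^ 2.
Proof.
apply: leq_trans (_ : #|setX [set p : G * G | sedge p.1 p.2]
                             [set p : G * G | sedge p.1 p.2]| <= _).
  apply/subset_leq_card/subsetP=> t; rewrite !inE.
  by case/exists_inP=> w _ /and3P[-> ->].
by rewrite cardsX expnS expn1 leq_mul // card_darts.
Qed.

Lemma edim_generator : exists2 Q : {set G}, edge_metric_generator Q & #|Q| = edim G.
Proof.
rewrite /edim; case: arg_minnP => [|Q gQ _]; first exact: edge_metric_generatorT.
by exists Q.
Qed.

Lemma edim_min (S : {set G}) : edge_metric_generator S -> edim G <= #|S|.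
Proof.
move=> gS; rewrite /edim; case: arg_minnP => [|Q _ minQ]; last exact: minQ.
exact: edge_metric_generatorT.
Qed.
End Cover.


(** * Terms for matrix access *)

Definition tnot a := Minus (Const 1) a.
Definition tneq a b := Minus (Const 1) (Minus (Const 1) (Plus (Minus a b) (Minus b a))).
Definition teq a b := tnot (tneq a b).
Definition tand a b := Cond a b (Const 0).
Definition tmin a b := Minus a (Minus a b).
(** The address of entry [b] in row [x] of the matrix which follows the word for
    the size.  The machine has no multiplication: the offset of the row is the sum
    of [r_size] over all indices below [x]. *)
Definition address x b :=
  Plus (Const 1)
    (Plus (Sum 19 (Cond (Minus (Var x) (Var 19)) (Var r_size) (Const 0))) b).
Definition cell x b := Fetch (address x b).

Section Eval.
Variables (m r : nat -> nat).
Local Notation ev := (teval m r).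

Lemma teval_neq a b : ev (tneq a b) = (ev a != ev b).
Proof. by rewrite /=; case: eqP => /=; lia. Qed.

Lemma teval_eq a b : ev (teq a b) = (ev a == ev b).
Proof. by rewrite /= (teval_neq a b : _ - _ = _); case: eqP. Qed.

Lemma teval_and a b : ev (tand a b) = if ev a != 0 then ev b else 0.
Proof. by []. Qed.

Lemma teval_plus a b : ev (Plus a b) = ev a + ev b.
Proof. by []. Qed.

Lemma teval_min a b : ev (tmin a b) = minn (ev a) (ev b).
Proof. by rewrite /=; lia. Qed.

Lemma teval_address x b : x != 19 -> r x <= r r_size ->
  ev (address x b) = (r x * r r_size + ev b).+1.
Proof.
move=> /negPf x19 le_x; rewrite /= x19 add1n; congr (_ + _).+1.
rewrite (eq_bigr (fun i : 'I__ => if i < r x then r r_size else 0)); last first.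
  by move=> i _; rewrite -lt0n subn_gt0.
rewrite -big_mkcond /= (big_ord_narrow le_x) big_const_ord iter_addn addn0.
by rewrite mulnC.
Qed.
End Eval.

(** A loop that achieves [Done i] in round [i] and does not lose what earlier
    rounds achieved ends with everything achieved. *)
Lemma run_for (Inv : state -> Prop) (Done : nat -> state -> Prop) x q s :
  Inv s ->
  (forall i s', i < regs s r_size -> Inv s' ->
    [/\ Inv (run q (set_reg x i s')), Done i (run q (set_reg x i s'))
      & forall j, Done j s' -> Done j (run q (set_reg x i s'))]) ->
  Inv (run (For x q) s) /\ forall i, i < regs s r_size -> Done i (run (For x q) s).
Proof.
move=> Inv0 step.
have [] := @iteri_inv _ (regs s r_size) (fun i s' => run q (set_reg x i s'))
  (fun i s' => Inv s' /\ forall j, j < i -> Done j s') s; [|by []|by []].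
move=> i s' lt_i [Inv_i Done_i]; have [Inv' Done' keep] := step i s' lt_i Inv_i.
by split=> // j; rewrite ltnS leq_eqVlt => /predU1P[->|/Done_i/keep].
Qed.

Section Memory.
Variable G : sgraph.
Let n := #|G|.

(** The matrix in the memory has one row more than the adjacency matrix: row [n],
    which the input leaves at zero, receives the flags of the chosen vertices. *)
Definition slot i (v : G) := (i * n + enum_rank v).+1.
Definition entry (u v : G) := slot (enum_rank u) v.

Lemma slot_inj i j u v : slot i u = slot j v -> i = j /\ u = v.
Proof.
move=> [E]; have n_gt0 : 0 < n by apply/card_gt0P; exists u.
have := congr1 (modn^~ n) E; have := congr1 (divn^~ n) E.
rewrite /= !modnMDl !divnMDl // !divn_small ?modn_small // !addn0 => -> /val_inj.
by move/enum_rank_inj.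
Qed.

Lemma eq_entry u v u' v' : (entry u v == entry u' v') = (u == u') && (v == v').
Proof.
apply/eqP/andP => [/slot_inj[/val_inj/enum_rank_inj -> ->]|[/eqP -> /eqP ->] //].
by rewrite !eqxx.
Qed.

Lemma slot_entry (w u v : G) : (slot n w == entry u v) = false.
Proof.
by apply/eqP => /slot_inj[]; have := ltn_ord (enum_rank u); rewrite -/n; lia.
Qed.

Lemma nth_allpairs (A B C : Type) (f : A -> B -> C) s t x0 y0 z i j :
  i < size s -> j < size t ->
  nth z [seq f x y | x <- s, y <- t] (i * size t + j) = f (nth x0 s i) (nth y0 t j).
Proof.
elim: s i => // x s IHs [|i] lt_i lt_j; rewrite allpairs_cons nth_cat size_map.
  by rewrite mul0n add0n lt_j (nth_map y0).
rewrite mulSn -addnA ltnNge leq_addr /= addnC addnK; exact: IHs.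
Qed.

Lemma nth_graph_code u v : nth 0 (graph_code G) (entry u v) = sedge u v.
Proof.
rewrite /= /n {2}cardE (nth_allpairs _ u u) -?cardE ?ltn_ord //.
by rewrite !nth_enum_rank.
Qed.

Lemma size_graph_code : size (graph_code G) = (n * n).+1.
Proof. by rewrite /= size_allpairs -cardE. Qed.

Lemma nth_graph_code_slot v : nth 0 (graph_code G) (slot n v) = 0.
Proof. by rewrite nth_default // size_graph_code ltnS leq_addr. Qed.

Lemma rank_surj i : i < n -> exists v : G, i = enum_rank v.
Proof. by move=> lt_i; exists (enum_val (Ordinal lt_i)); rewrite enum_valK. Qed.

Lemma teval_Sum m r x a : r r_size = n ->
  teval m r (Sum x a) = \sum_(v : G) teval m [eta r with x |-> nat_of_ord (enum_rank v)] a.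
Proof.
by move=> /= ->; rewrite (reindex (@enum_rank G)) //; apply/onW_bij/enum_rank_bij.
Qed.

Lemma teval_cell m r x b (u v : G) : x != 19 -> r r_size = n ->
  r x = enum_rank u -> teval m r b = enum_rank v ->
  teval m r (cell x b) = m (entry u v).
Proof.
move=> x19 rn rx bv; rewrite -[LHS]/(m (teval m r (address x b))).
by rewrite teval_address // ?rx ?bv ?rn // ltnW.
Qed.

Lemma teval_flag m r b (v : G) : r r_size = n -> teval m r b = enum_rank v ->
  teval m r (cell r_size b) = m (slot n v).
Proof.
move=> rn bv; rewrite -[LHS]/(m (teval m r (address r_size b))).
by rewrite teval_address // ?bv ?rn.
Qed.
End Memory.

(** * The program and its correctness *)

Notation r_out := 0 (only parsing).
Notation r_cov := 2 (only parsing).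
Notation r_best := 3 (only parsing).
Notation r_arg := 4 (only parsing).
Notation r_count := 5 (only parsing).
Notation r_round := 6 (only parsing).
Notation r_w := 7 (only parsing).
Notation r_u := 8 (only parsing).
Notation r_v := 9 (only parsing).
Notation r_x := 10 (only parsing).
Notation r_y := 11 (only parsing).
Notation r_z := 12 (only parsing).

(** An off-diagonal entry 0 means that the distance is not known yet; under this
    reading the adjacency matrix already contains all distances up to 1.  Round
    [i] enters the distance [i.+2] where some vertex at distance [i.+1] is adjacent
    to the target.  The levels start at 1 because an entry 0 off the diagonal is
    no distance. *)
Definition bfs_value :=
  Cond (cell r_u (Var r_v)) (cell r_u (Var r_v))
    (Cond (tand (tneq (Var r_u) (Var r_v))
             (Sum r_z (tand (teq (cell r_u (Var r_z)) (Plus (Var r_round) (Const 1)))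
                            (teq (cell r_z (Var r_v)) (Const 1)))))
       (Plus (Var r_round) (Const 2)) (Const 0)).

Definition bfs :=
  For r_round (For r_u (For r_v (Store (address r_u (Var r_v)) bfs_value))).

(** The number of quadruples covered by the flagged vertices together with
    [r_w]. *)
Definition cover_count :=
  Sum r_u (Sum r_v (Sum r_x (Sum r_y
    (tand (teq (cell r_u (Var r_v)) (Const 1))
    (tand (teq (cell r_x (Var r_y)) (Const 1))
      (tneq (Sum r_z
        (tand (Plus (cell r_size (Var r_z)) (teq (Var r_z) (Var r_w)))
              (tneq (tmin (cell r_u (Var r_z)) (cell r_v (Var r_z)))
                    (tmin (cell r_x (Var r_z)) (cell r_y (Var r_z))))))
        (Const 0))))))).

Definition search_best :=
  For r_w
    (Seq (Assign r_count cover_count)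
    (Seq (Assign r_arg (Cond (Minus (Var r_count) (Var r_best)) (Var r_w) (Var r_arg)))
         (Assign r_best (Cond (Minus (Var r_count) (Var r_best))
                              (Var r_count) (Var r_best))))).

(** When the best candidate brings no gain, its register may hold an old value;
    then the flag there is written back unchanged. *)
Definition pick_best :=
  Seq (Store (address r_size (Var r_arg))
         (Cond (Minus (Var r_best) (Var r_cov)) (Const 1) (cell r_size (Var r_arg))))
  (Seq (Assign r_out (Plus (Var r_out)
                        (Cond (Minus (Var r_best) (Var r_cov)) (Const 1) (Const 0))))
       (Assign r_cov (Var r_best))).

Definition greedy :=
  For r_round (Seq (Assign r_best (Var r_cov)) (Seq search_best pick_best)).

Definition edim_prog := Seq bfs greedy.

Definition assignable := [:: r_out; r_cov; r_best; r_arg; r_count].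

Lemma wf_edim_prog : wf assignable (r_size :: assignable) edim_prog.
Proof. by []. Qed.


(** From here on the terms are evaluated by their lemmas and not by
    unfolding. *)
Opaque tnot tneq teq tand tmin address cell.

Section Correct.
Variable G : sgraph.
Hypothesis connG : connected_graph G.
Let n := #|G|.

Lemma teval_bfs_value m r (u v : G) :
  r r_size = n -> r r_u = enum_rank u -> r r_v = enum_rank v ->
  teval m r bfs_value =
    if m (entry u v) != 0 then m (entry u v) else
    if (u != v) && [exists y, (m (entry u y) == (r r_round).+1) && (m (entry y v) == 1)]
    then (r r_round).+2 else 0.
Proof.
move=> rn ru rv; rewrite -[LHS]/(if teval m r (cell r_u (Var r_v)) != 0
  then teval m r (cell r_u (Var r_v)) else
  if teval m r (tand (tneq (Var r_u) (Var r_v))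
             (Sum r_z (tand (teq (cell r_u (Var r_z)) (Plus (Var r_round) (Const 1)))
                            (teq (cell r_z (Var r_v)) (Const 1))))) != 0
  then r r_round + 2 else 0).
rewrite (@teval_cell G _ _ _ _ u v) // addn2; case: ifP => // _; congr (if _ then _ else _).
rewrite teval_and teval_neq [teval _ _ (Var _)]ru [teval _ _ (Var _)]rv.
rewrite (inj_eq val_inj) (inj_eq enum_rank_inj).
case: (eqVneq u v) => [//|_]; rewrite -[LHS]/(teval m r (Sum _ _) != 0) [RHS]/=.
rewrite (teval_Sum _ _ _ rn) sum_nat_eq0 negb_forall; apply: eq_existsb => y.
rewrite teval_and !teval_eq /= (@teval_cell G _ _ _ _ u y) // (@teval_cell G _ _ _ _ y v) //.
by rewrite addn1; case: (m _ == _); case: (m _ == _).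
Qed.

Opaque bfs_value.

(** Every entry is unset or correct, which lets a round overwrite the matrix in
    place. *)
Definition bfs_inv i s :=
  [/\ regs s r_size = n, forall v : G, memory s (slot n v) = 0,
      forall u v : G, memory s (entry u v) = 0 \/ memory s (entry u v) = dist u v
    & forall u v : G, dist u v <= i.+1 -> memory s (entry u v) = dist u v].

(** The last clause says that correct entries stay correct, so the entries
    completed earlier in a round survive the rest of it. *)
Lemma bfs_storeP i s (u v : G) :
  bfs_inv i s -> regs s r_round = i ->
  regs s r_u = enum_rank u -> regs s r_v = enum_rank v ->
  let s' := run (Store (address r_u (Var r_v)) bfs_value) s in
  [/\ bfs_inv i s', dist u v <= i.+2 -> memory s' (entry u v) = dist u v
    & forall x y : G, memory s (entry x y) = dist x y ->
        memory s' (entry x y) = dist x y].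
Proof.
move=> [sn s0 s_or s_le] si su sv /=.
rewrite teval_address ?su ?sn; [|by []|exact/ltnW/ltn_ord].
rewrite -[(_ * _ + _).+1]/((enum_rank u * n + regs s r_v).+1) sv -/(entry u v).
rewrite (teval_bfs_value _ sn su sv) si.
set val := (if _ then _ else _).
have val0 : memory s (entry u v) = dist u v -> val = dist u v.
  rewrite /val; move=> ->; case: eqVneq => //= /eqP; rewrite dist_eq0 => /eqP uv.
  by rewrite uv eqxx /=; apply/esym/eqP; rewrite dist_eq0.
have val2 : dist u v <= i.+2 -> val = dist u v.
  rewrite leq_eqVlt => /predU1P[duv|]; last by move/s_le/val0.
  rewrite /val; case: eqVneq => [_|] /=; last by case: (s_or u v) => -> //; rewrite ?eqxx.
  rewrite ifT ?duv //; have [y uy yv] := dist_pred connG duv.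
  apply/andP; split; first by rewrite -dist_eq0 duv.
  apply/existsP; exists y; rewrite !s_le ?uy ?eqxx ?leqnn //=; first exact/eqP/dist_edge.
  by rewrite dist_edge.
(* A new value cannot exceed the distance: if the distance were at most
   [i.+1], the entry would be set already. *)
have val_or : val = 0 \/ val = dist u v.
  case: (leqP (dist u v) i.+1) => [/leqW/val2|lt_d]; first by right.
  case: (eqVneq (dist u v) i.+2) => [d2|ne_d].
    by right; apply: val2; rewrite d2.
  rewrite /val; case: ifP => [|_].
    by case: (s_or u v) => ->; [rewrite eqxx | right].
  case: ifP; last by left.
  case/andP=> _ /existsP[y /andP[/eqP uy /eqP yv]].
  have duy : dist u y = i.+1 by case: (s_or u y); rewrite uy.
  have dyv : sedge y v.
    by rewrite -(dist_eq1 connG); case: (s_or y v); rewrite yv // => <-.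
  by have := dist_step connG u dyv; rewrite duy => le; lia.
split=> [|/val2|x y]; rewrite ?eqxx //; last first.
  by rewrite eq_entry; case: eqP => //= ->; case: eqP => //= ->.
split=> //= [w|x y|x y le_d]; first by rewrite slot_entry.
  by rewrite eq_entry; case: eqP => //= ->; case: eqP => //= ->.
rewrite eq_entry; case: eqP => /= [xu|_]; last exact: s_le.
case: eqP => /= [yv|_]; last exact: s_le.
by rewrite xu yv; apply: val0; rewrite -xu -yv; apply: s_le.
Qed.

Lemma bfs_round i s : bfs_inv i s -> regs s r_round = i ->
  bfs_inv i.+1 (run (For r_u (For r_v (Store (address r_u (Var r_v)) bfs_value))) s).
Proof.
move=> inv si; have sn : regs s r_size = n by case: inv.
pose good j (s' : state) := forall u v : G, enum_rank u = j :> nat ->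
  dist u v <= i.+2 -> memory s' (entry u v) = dist u v.
have [||[inv' _] good'] := @run_for (fun s' => bfs_inv i s' /\ regs s' r_round = i)
  good r_u (For r_v (Store (address r_u (Var r_v)) bfs_value)) s.
- by [].
- rewrite sn => j s1 lt_j [inv1 si1]; have [u def_j] := rank_surj lt_j; subst j.
  pose s2 := set_reg r_u (enum_rank u) s1.
  have inv2 : bfs_inv i s2 by [].
  pose good2 k (s' : state) := forall v : G, enum_rank v = k :> nat ->
    dist u v <= i.+2 -> memory s' (entry u v) = dist u v.
  pose keep2 (s' : state) := forall x y : G, memory s1 (entry x y) = dist x y ->
    memory s' (entry x y) = dist x y.
  have [||[inv' [si' _] keep'] good'] := @run_for
    (fun s' => [/\ bfs_inv i s', regs s' r_round = i /\ regs s' r_u = enum_rank u & keep2 s'])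
    good2 r_v (Store (address r_u (Var r_v)) bfs_value) s2.
  + by split.
  + have -> : regs s2 r_size = n by case: inv2.
    move=> k s3 lt_k [inv3 [si3 su3] keep3]; have [v def_k] := rank_surj lt_k; subst k.
    have [||||inv4 good4 keep4] := @bfs_storeP i (set_reg r_v (enum_rank v) s3) u v.
    * by [].
    * by [].
    * by rewrite /= su3.
    * by [].
    split.
    * by split=> // x y /keep3/keep4.
    * by move=> v' /val_inj/enum_rank_inj ->; apply: good4.
    by move=> l good_l v' def_l le_d; apply/keep4/good_l.
  split=> //.
    move=> u' v /val_inj/enum_rank_inj -> le_d.
    by apply: (good' (enum_rank v)) => //; case: inv2 => ->.
  by move=> l good_l u' v def_l le_d; apply/keep'/(good_l u').
case: inv' => n' z' or' _; split=> // u v le_d.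
by apply: (good' (enum_rank u)) => //; rewrite sn.
Qed.

Definition memory_spec (S : {set G}) (m : nat -> nat) :=
  (forall u v : G, m (entry u v) = dist u v) /\
  (forall v : G, m (slot n v) = (v \in S)).

(** In a connected graph all distances are below [n], so [n] rounds suffice. *)
Lemma bfsP s : bfs_inv 0 s ->
  [/\ regs (run bfs s) r_size = n, memory_spec set0 (memory (run bfs s))
    & forall x, x \in assignable -> regs (run bfs s) x = regs s x].
Proof.
move=> inv; have sn : regs s r_size = n by case: inv.
have [n' z' _ le'] : bfs_inv n (run bfs s).
  rewrite /bfs -[run _ _]/(iteri (regs s r_size) _ s) sn.
  by apply: iteri_inv => // i s' _ inv'; apply: bfs_round.
split=> // [|x x_as]; last first.
  by apply: (@run_frame [::] (r_size :: assignable)); rewrite // inE x_as orbT.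
split=> [u v|v]; last by rewrite inE.
by apply/le'/leqW/ltnW/dist_lt.
Qed.

Lemma teval_cover_count S m r (w : G) :
  r r_size = n -> r r_w = enum_rank w -> memory_spec S m ->
  teval m r cover_count = #|covered (@separates G) (w |: S)|.
Proof.
move=> rn rw [mdist mS].
have -> : #|covered (@separates G) (w |: S)| = \sum_(u : G) \sum_(v : G) \sum_(x : G)
    \sum_(y : G) (((u, v), (x, y)) \in covered (@separates G) (w |: S)).
  under eq_bigr => u _ do under eq_bigr => v _ do rewrite pair_bigA /=.
  rewrite !pair_bigA /= -sum1_card big_mkcond /=; apply: eq_bigr => [[[u v] [x y]] _] /=.
  by case: (_ \in _).
rewrite /cover_count (@teval_Sum G) //; apply: eq_bigr => u _.
rewrite (@teval_Sum G) //; apply: eq_bigr => v _.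
rewrite (@teval_Sum G) //; apply: eq_bigr => x _.
rewrite (@teval_Sum G) //; apply: eq_bigr => y _.
set r' := [eta _ with _ |-> _].
rewrite !teval_and !teval_eq (@teval_cell G _ _ _ _ u v) //.
rewrite (@teval_cell G _ _ _ _ x y) // !mdist !dist_eq1 // teval_neq.
rewrite in_covered; case uv: (sedge u v) => //; case xy: (sedge x y) => //.
rewrite !andTb -[LHS]/(nat_of_bool (teval m r' (Sum _ _) != 0)).
congr nat_of_bool; rewrite (@teval_Sum G) // sum_nat_eq0 negb_forall; apply: eq_existsb => z.
rewrite /= teval_and teval_neq !teval_min.
rewrite (@teval_cell G _ _ _ _ u z) // (@teval_cell G _ _ _ _ v z) //.
rewrite (@teval_cell G _ _ _ _ x z) // (@teval_cell G _ _ _ _ y z) // !mdist.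
rewrite teval_plus (@teval_flag G _ _ _ z) // mS teval_eq /= rw.
rewrite (inj_eq val_inj) (inj_eq enum_rank_inj).
rewrite /distinguishes !edge_dist2 // !inE.
by case: (z \in S); case: (z == w); case: (minn _ _ != _).
Qed.

Opaque cover_count.

(** The register [r_arg] is meaningful only once a candidate has beaten the
    current cover. *)
Lemma search_bestP S s :
  regs s r_size = n -> memory_spec S (memory s) ->
  regs s r_cov = #|covered (@separates G) S| -> regs s r_best = regs s r_cov ->
  let s' := run search_best s in
  [/\ memory s' = memory s,
      [/\ regs s' r_size = n, regs s' r_out = regs s r_out & regs s' r_cov = regs s r_cov],
      regs s' r_best = regs s r_cov \/ exists w : G,
        regs s' r_arg = enum_rank w /\
        regs s' r_best = #|covered (@separates G) (w |: S)|
    & forall w : G, #|covered (@separates G) (w |: S)| <= regs s' r_best].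
Proof.
move=> sn spec sc sb.
have [||[m' r' b'] max'] := @run_for (fun s' => [/\ memory s' = memory s,
      [/\ regs s' r_size = n, regs s' r_out = regs s r_out & regs s' r_cov = regs s r_cov]
    & regs s' r_best = regs s r_cov \/ exists w : G,
        regs s' r_arg = enum_rank w /\
        regs s' r_best = #|covered (@separates G) (w |: S)|])
  (fun i s' => forall w : G, enum_rank w = i :> nat ->
     #|covered (@separates G) (w |: S)| <= regs s' r_best)
  r_w (Seq (Assign r_count cover_count)
    (Seq (Assign r_arg (Cond (Minus (Var r_count) (Var r_best)) (Var r_w) (Var r_arg)))
         (Assign r_best (Cond (Minus (Var r_count) (Var r_best))
                              (Var r_count) (Var r_best))))) s.
- by split=> //; left.
- rewrite sn => i s1 lt_i [m1 [n1 o1 c1] b1]; have [w def_i] := rank_surj lt_i; subst i.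
  rewrite /= (@teval_cover_count S _ _ w) //=; last by rewrite m1.
  set c := #|covered (@separates G) (w |: S)|.
  case: (posnP (c - regs s1 r_best)) => [le_c|lt_c].
    split=> // w' /val_inj/enum_rank_inj ->.
    by rewrite -subn_eq0 -/c le_c.
  split=> /= [|w'|j le_j w' def_j].
  + by split=> //; right; exists w.
  + by move/val_inj/enum_rank_inj=> ->.
  by apply: leq_trans (le_j w' def_j) _; lia.
split=> // w; apply: (max' (enum_rank w)) => //.
by rewrite sn.
Qed.

Definition greedy_state q i s :=
  exists S : {set G}, [/\ regs s r_size = n, memory_spec S (memory s),
    regs s r_out = #|S|, regs s r_cov = #|covered (@separates G) S|
    & greedy_inv (@separates G) q i S].

Lemma greedy_round Q i s :
  covered (@separates G) Q = covered (@separates G) [set: G] ->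
  greedy_state #|Q| i s ->
  greedy_state #|Q| i.+1
    (run (Seq (Assign r_best (Var r_cov)) (Seq search_best pick_best)) s).
Proof.
move=> QU [S [sn spec so sc inv]].
rewrite -[run _ _]/(run pick_best (run search_best (set_reg r_best (regs s r_cov) s))).
have [] := @search_bestP S (set_reg r_best (regs s r_cov) s) sn spec sc erefl.
move: (run search_best _) => s1 /= m1 [n1 o1 c1] b1 max1.
rewrite /pick_best /= teval_address ?n1 //=.
rewrite -[(_ * _ + _).+1]/((n * n + regs s1 r_arg).+1).
case: (posnP (regs s1 r_best - regs s1 r_cov)) => [le_b|lt_b].
  have sb : regs s1 r_best = #|covered (@separates G) S|.
    apply/eqP; rewrite -sc -c1 eqn_leq -subn_eq0 le_b eqxx /=.
    (* A connected graph has a vertex, and any candidate covers at least as much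
       as [S] alone. *)
    have := max1 (enum_val (Ordinal (proj1 connG))).
    rewrite c1 sc; apply: leq_trans.
    by rewrite subset_leq_card // coveredS // subsetUr.
  exists S; split=> //=.
  - have -> : teval (memory s1) (regs s1) (cell r_size (Var r_arg)) =
        memory s1 (n * n + regs s1 r_arg).+1.
      rewrite -[LHS]/(memory s1 (teval (memory s1) (regs s1) (address r_size (Var r_arg)))).
      by rewrite teval_address ?n1.
    by rewrite m1; split=> [x y|x] /=; case: eqP => [<-|_]; apply spec.
  - by rewrite addn0 o1.
  by apply: greedy_inv_stop QU _ inv => w; rewrite -sb.
have [w [sw sb]] : exists w : G, regs s1 r_arg = enum_rank w /\
    regs s1 r_best = #|covered (@separates G) (w |: S)|.
  by case: b1 => // b1; move: lt_b; rewrite b1 c1 subnn.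
have lt_cov : #|covered (@separates G) S| < #|covered (@separates G) (w |: S)|.
  by rewrite -sb -sc -c1 -subn_gt0.
exists (w |: S); split=> //=.
- rewrite sw -/(slot n w) m1; split=> [x y|x] /=.
    by rewrite eq_sym slot_entry; apply spec.
  rewrite !inE; case: (eqVneq x w) => [->|xw]; first by rewrite eqxx.
  rewrite ifF; first by apply spec.
  by apply: contraNF xw => /eqP/slot_inj[_ ->].
- rewrite o1 so cardsU1 addnC (_ : w \notin S) //.
  by apply: contraL lt_cov => wS; rewrite (setUidPr _) ?ltnn // sub1set.
by apply: greedy_inv_pick QU _ _ inv => // w'; rewrite -sb.
Qed.

Lemma greedyP Q s :
  covered (@separates G) Q = covered (@separates G) [set: G] ->
  regs s r_size = n -> memory_spec set0 (memory s) ->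
  regs s r_out = 0 -> regs s r_cov = 0 ->
  greedy_state #|Q| n (run greedy s).
Proof.
move=> QU sn spec so sc; rewrite /greedy -[run _ _]/(iteri (regs s r_size) _ s) sn.
apply: iteri_inv => [i s' _ inv|]; first exact: (@greedy_round Q i (set_reg r_round i s')).
exists set0; split; rewrite // ?so ?sc ?cards0 //; last exact: greedy_inv0.
by apply/esym/eqP; rewrite cards_eq0; apply/eqP/setP => t; rewrite !inE;
  apply/existsP => -[w]; rewrite inE.
Qed.
End Correct.

(** * The approximation ratio *)

Definition edim_cmd := CSeq (CAssign r_size (ELoad (EConst 0))) (compile edim_prog).

Lemma edim_cmd_poly :
  exists a d, forall w, nth 0 w 0 < size w -> exists t s',
    [/\ exec edim_cmd (init_state w) t s', t <= a * size w ^ d + a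
      & regs s' r_out =
        regs (run edim_prog (set_reg r_size (nth 0 w 0) (init_state w))) r_out].
Proof.
have [a [d costP]] := poly_bounded_cost edim_prog.
exists (a + 3), d => w lt_w.
set s := set_reg r_size (nth 0 w 0) (init_state w).
have [||||||u [s' [ex le_u _ r']]] :=
    @compileP assignable edim_prog (r_size :: assignable) s s wf_edim_prog.
- by [].
- by [].
- by [].
- by move=> x xa; rewrite inE xa orbT.
- by [].
- by [].
exists (3 + u), s'; split.
- exact: ExecSeq (ExecAssign (init_state w) r_size (ELoad (EConst 0))) ex.
- have le_a : cost (nth 0 w 0) edim_prog <= a * size w ^ d.
    apply: leq_trans (costP _) _; rewrite leq_mul2l; case: (d) => [|e].
      by rewrite orbT.
    by rewrite leq_exp2r ?lt_w ?orbT.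
  have := leq_trans le_u le_a; rewrite mulnDl; move: (_ * _) (_ * _) => X Y; lia.
- exact: r'.
Qed.

Lemma edim_cmdP (G : sgraph) : connected_graph G ->
  let k := regs (run edim_prog (set_reg r_size (nth 0 (graph_code G) 0)
                                  (init_state (graph_code G)))) r_out in
  edim G <= k /\
  (0 < k -> 0 < edim G /\
     edim G ^ k.-1 <= (#|edges G| * 2) ^ 2 * (edim G).-1 ^ k.-1).
Proof.
move=> connG; set s := set_reg _ _ _ => k.
have inv0 : bfs_inv G 0 s.
  split=> // [v|u v|u v le_d]; first exact: nth_graph_code_slot.
    rewrite [memory _ _]nth_graph_code; case uv: (sedge u v); last by left.
    by right; rewrite dist_edge.
  rewrite [memory _ _]nth_graph_code -(dist_eq1 connG).
  by case: (dist u v) le_d => [|[]].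
have [rn spec keep] := bfsP connG inv0.
have [Q gQ cardQ] := edim_generator G.
have QU : covered (@separates G) Q = covered (@separates G) [set: G].
  by apply/eqP; rewrite -generator_cover.
have [||S [_ _ kS _ inv]] := greedyP connG QU rn spec.
- by rewrite keep.
- by rewrite keep.
have def_k : k = #|S| by rewrite -kS.
rewrite def_k -cardQ; split.
  by rewrite cardQ edim_min // generator_cover (greedy_inv_full inv).
case: inv => _ _ inv /inv[Q_gt0 le_q]; split=> //.
by apply: leq_trans le_q _; rewrite leq_mul2r card_covered orbT.
Qed.

Local Open Scope classical_set_scope.
Local Open Scope ring_scope.
Import Order.TTheory GRing.Theory Num.Theory.

(** This rests on 1 - 1/q <= exp (-1/q); the hypothesis then gives
    exp (j/q) <= u. *)
Lemma greedy_ratio (R : realType) (q j u : nat) :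
  (0 < q)%N -> (q ^ j <= u * q.-1 ^ j)%N -> j%:R <= ln (u%:R : R) * q%:R.
Proof.
case: q => // q _ /= le_u.
have u_gt0 : (0 < u)%N by case: u le_u => //; rewrite mul0n leqn0 expn_eq0.
have q_gt0 : 0 < q.+1%:R :> R by rewrite ltr0n.
have le_exp : q%:R <= q.+1%:R * expR (- q.+1%:R^-1) :> R.
  apply: le_trans (_ : _ <= q.+1%:R * (1 - q.+1%:R^-1)) _.
    by rewrite mulrBr mulr1 divff ?gt_eqF // -natr1 addrK.
  by rewrite ler_pM2l // expR_ge1Dx.
have le_uR : q.+1%:R ^+ j <= u%:R * q%:R ^+ j :> R.
  by rewrite -!natrX -natrM ler_nat.
rewrite -ler_pdivrMr // -ler_expR lnK ?posrE ?ltr0n //.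
rewrite -[j%:R / _]opprK expRN -mulrN expRM_natl -[leLHS]mul1r.
rewrite ler_pdivrMr ?exprn_gt0 ?expR_gt0 //.
rewrite -(ler_pM2l (exprn_gt0 j q_gt0)) mulr1 mulrCA -exprMn.
apply: le_trans le_uR _; rewrite ler_wpM2l ?ler0n //.
by rewrite lerXn2r ?nnegrE ?ler0n ?mulr_ge0 ?expR_ge0.
Qed.

Definition greedy_factor (R : realType) (m : nat) : R := 1 + ln ((m * 2) ^ 2)%:R.

(** For m >= 4 we have (2m)^2 <= m^3, and 1 <= ln m as soon as m >= e. *)
Lemma greedy_factor_bigO (R : realType) :
  (greedy_factor R : nat -> R^o) =O_\oo (fun m : nat => ln m%:R : R^o).
Proof.
apply/eqO_exP; exists 4 => //; near=> m.
have m4 : (4 <= m)%N by near: m; exact: nbhs_infty_ge.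
have m_gt0 : 0 < m%:R :> R by rewrite ltr0n (leq_trans _ m4).
have ln_m : 1 <= ln m%:R :> R.
  rewrite -ler_expR lnK ?posrE //; near: m; exact: nbhs_infty_ger.
have le3 : ln ((m * 2) ^ 2)%:R <= 3 * ln m%:R :> R.
  rewrite mulr_natl -lnXn // ler_ln ?posrE ?exprn_gt0 // -?natrX ?ler_nat ?ltr0n; nia.
have ge0 : 0 <= ln ((m * 2) ^ 2)%:R :> R by apply: ln_ge0; rewrite ler1n; nia.
rewrite /greedy_factor !ger0_norm ?addr_ge0 ?(le_trans _ ln_m) //.
by rewrite -[4]/(1 + 3) mulrDl mul1r lerD.
Unshelve. all: by end_near.
Qed.

Theorem theorem19 (R : realType) :
  exists alpha : nat -> R,
    (alpha : nat -> R^o) =O_\oo (fun m : nat => ln m%:R : R^o) /\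
    exists (c : cmd) (a d : nat),
      forall G : sgraph, connected_graph G ->
        exists k : nat,
          [/\ computes_within c (graph_code G) k
                (a * size (graph_code G) ^ d + a)%N,
              (edim G <= k)%N &
              k%:R <= alpha #|edges G| * (edim G)%:R].
Proof.
exists (@greedy_factor R); split; first exact: greedy_factor_bigO.
have [a [d timeP]] := edim_cmd_poly.
exists edim_cmd, a, d => G connG; have [le_k ratio] := edim_cmdP connG.
set k := regs _ _ in le_k ratio; exists k; split=> //.
  have [|t [s' [ex le_t out]]] := timeP (graph_code G).
    by rewrite size_graph_code /= ltnS; nia.
  by exists t, s'.
have [k0|k_gt0] := posnP k.
  have -> : edim G = 0%N by apply/eqP; rewrite -leqn0 -k0.
  by rewrite k0 mulr0.
have [q_gt0 le_q] := ratio k_gt0.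
have := greedy_ratio R q_gt0 le_q; rewrite /greedy_factor mulrDl mul1r => le_j.
by rewrite -(prednK k_gt0) -natr1 addrC lerD // ler1n.
Qed.
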